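(* Let $G$ be a finite-dimensional Lie group, $V$ an $n$-dimensional real vector space, $\Phi:G\to\mathrm{Aut}(V)$ a representation, and $\rho:G\times V\to V$, $\rho(a,p)=\Phi(a)(p)$, the corresponding group action. Then the tangent map $T\rho:TG\times TV\to TV$ is a group action of $TG$ on $TV$ that corresponds to the prolongation $\widetilde{\Phi}:TG\to\mathrm{Aut}(TV)$ of $\Phi$, i.e. $T\rho(X,Y)=\widetilde{\Phi}(X)(Y)$ for all $X\in TG$, $Y\in TV$.
   Context: Representations are finite-dimensional and real: a representation of a Lie group $G$ on $V$ is a Lie group homomorphism $\Phi:G\to \mathrm{Aut}(V)$, where $\mathrm{Aut}(V)$ is the Lie group of linear automorphisms of $V$. $T$ denotes the tangent bundle of a manifold and the tangent map (differential) of a smooth map. $TG$ is a Lie group with multiplication $T\mu:TG\times TG\to TG$, where $\mu$ is the multiplication of $G$. For manifolds $M,N$, $T(M\times N)$ is identified with $TM\times TN$: $(X,Y)$ with $X\in T_xM$, $Y\in T_yN$ corresponds to $Tf_x(Y)+T\bar f_y(X)$, where $f_x(m)=(x,m)$ and $\bar f_y(m)=(m,y)$. Vector space structure on $TV$: for $X\in T_xV$, $Y\in T_yV$, $\lambda\in\mathbb{R}$, set $X\oplus Y=(T\tau_y)X+(T\tau_x)Y\in T_{x+y}V$ and $\lambda\bullet X=(T\sigma_\lambda)X\in T_{\lambda x}V$, where $\tau_x:V\to V$ is translation by $x$ and $\sigma_\lambda:V\to V$ is multiplication by $\lambda$. With these operations $TV$ is a real vector space of dimension $2n$. Bases: fix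 a basis $\{\alpha_1,\dots,\alpha_n\}$ of $V$ with associated linear coordinate functions $x_1,\dots,x_n$ on $V$, and let $e_1,\dots,e_n$ be the standard basis of $\mathbb{R}^n$. Let $\psi:TV\to V\times\mathbb{R}^n$, $\psi(v)=(p,\sum_i v[x_i]e_i)$ for $v\in T_pV$. Put $\widetilde{\alpha}_i=\psi^{-1}(\alpha_i,0)$, $\widetilde{y}_i=\psi^{-1}(0,e_i)$; then $(\widetilde\alpha_1,\dots,\widetilde\alpha_n,\widetilde y_1,\dots,\widetilde y_n)$ is a basis of $TV$. Maps: $Z:\mathrm{Aut}(V)\to GL(n,\mathbb{R})$ sends an automorphism to its matrix with respect to $(\alpha_i)$, and $\breve Z:\mathrm{Aut}(TV)\to GL(2n,\mathbb{R})$ sends an automorphism to its matrix with respect to $(\widetilde\alpha_1,\dots,\widetilde\alpha_n,\widetilde y_1,\dots,\widetilde y_n)$. Every element of $T(GL(n,\mathbb{R}))$ at $a\in GL(n,\mathbb{R})$ is uniquely of the form $[a,B]:=TR_a(B)$ with $B\in \mathrm{Lie}(GL(n,\mathbb{R}))=T_eGL(n,\mathbb{R})$ and $R_a(y)=ya$. The one-to-one Lie group homomorphism $J_n:T(GL(n,\mathbb{R}))\to GL(2n,\mathbb{R})$ is $J_n([a,B])=\begin{pmatrix} a & 0\\ Ba & a\end{pmatrix}$. The prolongation of $\Phi$ to $TG$ is the representation $\widetilde{\Phi}=\breve{Z}^{-1}\circ J_n\circ TZ\circ T\Phi:TG\to\mathrm{Aut}(TV)$. *)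

(* Defs.v *)
From HB Require Import structures.
From mathcomp Require Import all_boot all_order all_algebra.
From mathcomp Require Import all_classical all_reals.
From mathcomp Require Import topology normedtype landau derive.

Set Implicit Arguments.
Unset Strict Implicit.
Unset Printing Implicit Defensive.

Import Order.TTheory GRing.Theory Num.Theory.
Import numFieldNormedType.Exports.

Local Open Scope classical_set_scope.
Local Open Scope ring_scope.

(* C^k and smooth maps on an open set U of a finite-dimensional normed space:
   all iterated directional derivatives exist and are continuous. *)
Section Smooth.
Context {R : realType} {E F : normedModType R}.

Fixpoint Ck (k : nat) (U : set E) (f : E -> F) : Prop :=
  if k is k'.+1 then
    (forall x, U x -> differentiable f x) /\
    (forall v : E, Ck k' U (fun x => 'D_v f x))
  else forall x, U x -> {for x, continuous f}.

Definition smooth_on (U : set E) (f : E -> F) : Prop := forall k, Ck k U f.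

End Smooth.

(* [cinv] is the inverse of [cmap] on [cmap @` cdom]; elsewhere both functions
   take irrelevant values. *)
Record chart (E M : Type) := Chart {
  cdom : set M;
  cmap : M -> E;
  cinv : E -> M }.

(* An atlas on M modelled on E, with a preferred chart around every point; the
   manifold axioms are in [is_manifold]. *)
Record charted {R : realType} (E : normedModType R) (M : Type) := Charted {
  atlas : set (chart E M);
  chart_at : M -> chart E M }.

(* The tangent bundle: a tangent vector at p is given by its coordinates [tvec]
   in the preferred chart at p, so the vector space structure of the tangent
   space at p is that of the model space. *)
Record tangent {R : realType} {E : normedModType R} {M : Type}
    (cM : charted E M) := Tangent { tbase : M; tvec : E }.

Section Manifolds.
Context {R : realType}.

Section OneManifold.
Context {E : normedModType R} {M : Type} (cM : charted E M).

Record is_manifold : Prop := IsManifold {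
  chart_at_atlas : forall p, atlas cM (chart_at cM p);
  chart_at_dom : forall p, cdom (chart_at cM p) p;
  chartK : forall c, atlas cM c -> forall p, cdom c p -> cinv c (cmap c p) = p;
  overlap_open : forall c d, atlas cM c -> atlas cM d ->
    open (cmap c @` (cdom c `&` cdom d));
  transition_smooth : forall c d, atlas cM c -> atlas cM d ->
    smooth_on (cmap c @` (cdom c `&` cdom d)) (cmap d \o cinv c) }.

(* The topology induced by the atlas. *)
Definition mopen (A : set M) : Prop :=
  forall c, atlas cM c -> open (cmap c @` (cdom c `&` A)).

Definition mhausdorff : Prop := forall p q, p <> q ->
  exists A B, [/\ mopen A, mopen B, A p, B q & A `&` B = set0].

Definition msecond_countable : Prop := exists B : nat -> set M,
  (forall i, mopen (B i)) /\
  (forall A p, mopen A -> A p -> exists i, B i p /\ B i `<=` A).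

(* v[f], the derivative of f along v *)
Definition dirder (v : tangent cM) (f : M -> R) : R :=
  let c := chart_at cM (tbase v) in
  'd (f \o cinv c) (cmap c (tbase v)) (tvec v).

End OneManifold.

Definition smooth_map {E F : normedModType R} {M N : Type}
    (cM : charted E M) (cN : charted F N) (f : M -> N) : Prop :=
  forall c d, atlas cM c -> atlas cN d ->
    let U := cmap c @` (cdom c `&` f @^-1` cdom d) in
    open U /\ smooth_on U (cmap d \o f \o cinv c).

Definition tmap {E F : normedModType R} {M N : Type}
    {cM : charted E M} {cN : charted F N} (f : M -> N) (v : tangent cM) :
    tangent cN :=
  let c := chart_at cM (tbase v) in
  let d := chart_at cN (f (tbase v)) in
  Tangent cN (f (tbase v))
    ('d (cmap d \o f \o cinv c) (cmap c (tbase v)) (tvec v)).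

Section Product.
Context {E F : normedModType R} {M N : Type}.
Context (cM : charted E M) (cN : charted F N).

Definition prod_chart (c : chart E M) (d : chart F N) :
    chart (E * F)%type (M * N)%type :=
  Chart (cdom c `*` cdom d)
        (fun p => (cmap c p.1, cmap d p.2))
        (fun x => (cinv c x.1, cinv d x.2)).

Definition prod_charted : charted (E * F)%type (M * N)%type :=
  Charted
    [set b | exists c d, [/\ atlas cM c, atlas cN d & b = prod_chart c d]]
    (fun p => prod_chart (chart_at cM p.1) (chart_at cN p.2)).

End Product.

(* The identification of TM * TN with T(M * N).  The two summands below are
   tangent vectors at the same point (x, y). *)
Definition tpair {E F : normedModType R} {M N : Type}
    {cM : charted E M} {cN : charted F N}
    (X : tangent cM) (Y : tangent cN) : tangent (prod_charted cM cN) :=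
  let x := tbase X in
  let y := tbase Y in
  Tangent (prod_charted cM cN) (x, y)
    (tvec (tmap (cN := prod_charted cM cN) (fun m => (x, m)) Y)
     + tvec (tmap (cN := prod_charted cM cN) (fun m => (m, y)) X)).

Section TangentManifold.
Context {E : normedModType R} {M : Type} (cM : charted E M).

(* The chart (p, v) |-> (c(p), dc_p(v)) of TM induced by a chart c of M. *)
Definition tangent_chart (c : chart E M) : chart (E * E)%type (tangent cM) :=
  Chart [set v | cdom c (tbase v)]
    (fun v => let b := chart_at cM (tbase v) in
       (cmap c (tbase v), 'd (cmap c \o cinv b) (cmap b (tbase v)) (tvec v)))
    (fun x => let p := cinv c x.1 in
       Tangent cM p ('d (cmap (chart_at cM p) \o cinv c) (x.1) x.2)).

Definition tangent_charted : charted (E * E)%type (tangent cM) :=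
  Charted [set tangent_chart c | c in atlas cM]
          (fun v => tangent_chart (chart_at cM (tbase v))).

End TangentManifold.

(* Smooth left actions H * M -> M of a group H with multiplication [mul]
   and identity [one]. *)
Record is_lie_action {E F : normedModType R} {H M : Type}
    (cH : charted E H) (cM : charted F M)
    (mul : H -> H -> H) (one : H) (act : H * M -> M) : Prop := IsLieAction {
  act_one : forall y, act (one, y) = y;
  act_mul : forall a b y, act (mul a b, y) = act (a, act (b, y));
  act_smooth : smooth_map (prod_charted cH cM) cM act }.

End Manifolds.

Section LieGroup.
Context {R : realType} {m : nat} {G : groupType} (cG : charted 'rV[R]_m G).
Local Open Scope group_scope.

Definition mulG (x : G * G) : G := x.1 * x.2.

Record is_lie_group : Prop := IsLieGroup {
  lie_manifold : is_manifold cG;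
  lie_hausdorff : mhausdorff cG;
  lie_second_countable : msecond_countable cG;
  lie_mul_smooth : smooth_map (prod_charted cG cG) cG mulG;
  lie_inv_smooth : smooth_map cG cG (fun x : G => x^-1) }.

(* The group law T mu of TG, and its identity: the zero vector at 1. *)
Definition tmul (X Y : tangent cG) : tangent cG := tmap mulG (tpair X Y).

Definition tone : tangent cG := Tangent cG 1 0%R.

End LieGroup.

Section LinearAlgebra.
Context {R : realType}.

Definition GL (n : nat) := {A : 'M[R]_n | A \in unitmx}.

Definition GL1 n : GL n := Sub 1%:M (unitmx1 R n).

Lemma GLmul_subproof n (A B : GL n) : val A *m val B \in unitmx.
Proof. by rewrite unitmx_mul (valP A) (valP B). Qed.

Definition GLmul n (A B : GL n) : GL n :=
  Sub (val A *m val B) (GLmul_subproof A B).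

Definition Aut (W : vectType R) := {f : 'End(W) | lker f == 0%VS}.

Record vect_basis (W : vectType R) (n : nat) := VectBasis {
  basis_tuple :> n.-tuple W;
  basisP : basis_of fullv basis_tuple }.

Section Matrix.
Context {W : vectType R} {n : nat} (b : vect_basis W n).

Definition coords (v : W) : 'rV[R]_n := \row_i coord b i v.

Definition lincomb (x : 'rV[R]_n) : W := \sum_i x 0 i *: tnth b i.

Fact coords_linear : linear coords.
Proof. by move=> k u v; apply/rowP => i; rewrite !mxE linearP. Qed.

HB.instance Definition _ :=
  GRing.isSemilinear.Build R W 'rV[R]_n _ coords
    (GRing.semilinear_linear coords_linear).

Fact lincomb_linear : linear lincomb.
Proof.
move=> k x y; rewrite /lincomb scaler_sumr -big_split /=.
by apply: eq_bigr => i _; rewrite !mxE scalerDl scalerA.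
Qed.

HB.instance Definition _ :=
  GRing.isSemilinear.Build R 'rV[R]_n W _ lincomb
    (GRing.semilinear_linear lincomb_linear).

Lemma coordsK : cancel coords lincomb.
Proof.
move=> v; rewrite /lincomb [RHS](coord_basis (basisP b) (memvf v)).
by apply: eq_bigr => i _; rewrite mxE (tnth_nth 0).
Qed.

Lemma coord_tnth (i j : 'I_n) : coord b i (tnth b j) = (i == j)%:R.
Proof.
by have bF := basis_free (basisP b); rewrite (tnth_nth 0) coord_free // eq_sym.
Qed.

Lemma lincombK : cancel lincomb coords.
Proof.
move=> x; apply/rowP => i; rewrite mxE /lincomb linear_sum (bigD1 i) //=.
rewrite linearZ /= coord_tnth eqxx mulr1 big1 ?addr0 // => j neq_ji.
by rewrite linearZ /= coord_tnth eq_sym (negPf neq_ji) mulr0.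
Qed.

(* Column convention: f b_j = \sum_i (fmat f) i j *: b_i *)
Definition fmat (f : 'End(W)) : 'M[R]_n :=
  \matrix_(i, j) coord b i (f (tnth b j)).

Definition mxfun (A : 'M[R]_n) : 'End(W) :=
  linfun (lincomb \o mulmxr A^T \o coords).

Lemma coords_fmat (f : 'End(W)) v : coords (f v) = coords v *m (fmat f)^T.
Proof.
rewrite -{1}[v]coordsK /lincomb linear_sum /=; apply/rowP => i.
rewrite !mxE linear_sum /=; apply: eq_bigr => j _.
by rewrite !linearZ /= !mxE.
Qed.

Lemma coords_mxfun (A : 'M[R]_n) v : coords (mxfun A v) = coords v *m A^T.
Proof. by rewrite lfunE /= lincombK. Qed.

Lemma fmatK : cancel fmat mxfun.
Proof.
move=> f; apply/lfunP => v; apply: (can_inj coordsK).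
by rewrite coords_mxfun coords_fmat.
Qed.

Lemma mxfunK : cancel mxfun fmat.
Proof.
move=> A; apply/matrixP => i j; rewrite mxE.
transitivity (coords (mxfun A (tnth b j)) 0 i); first by rewrite mxE.
rewrite coords_mxfun mxE (bigD1 j) //= !mxE coord_tnth eqxx mul1r.
rewrite big1 ?addr0 // => k neq_kj.
by rewrite mxE coord_tnth (negPf neq_kj) mul0r.
Qed.

Lemma Zmx_subproof (f : Aut W) : fmat (val f) \in unitmx.
Proof.
suff /mulmx1_unit[] : fmat (val f) *m fmat (val f)^-1%VF = 1%:M by [].
apply: trmx_inj; rewrite trmx_mul trmx1; apply/row_matrixP => i.
rewrite !rowE mulmxA mulmx1 -[delta_mx 0 i]lincombK -!coords_fmat.
by rewrite lker0_lfunVK ?(valP f).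
Qed.

(* The map Z: Aut(W) -> GL(n, R) attached to the basis b, and its inverse *)
Definition Zmx (f : Aut W) : GL n := Sub (fmat (val f)) (Zmx_subproof f).

Lemma Zmx_inv_subproof (A : GL n) : lker (mxfun (val A)) == 0%VS.
Proof.
apply/lker0P => u v /(congr1 coords); rewrite !coords_mxfun.
move=> /(congr1 (mulmxr (invmx (val A)^T))) /=.
by rewrite !mulmxK ?unitmx_tr ?(valP A) // => /(can_inj coordsK).
Qed.

Definition Zmx_inv (A : GL n) : Aut W :=
  Sub (mxfun (val A)) (Zmx_inv_subproof A).

Lemma ZmxK : cancel Zmx Zmx_inv.
Proof. by move=> f; apply: val_inj => /=; rewrite fmatK. Qed.

Lemma Zmx_invK : cancel Zmx_inv Zmx.
Proof. by move=> A; apply: val_inj => /=; rewrite mxfunK. Qed.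

End Matrix.

Section LinearManifolds.
Context {V : vectType R} {n : nat} (e : vect_basis V n).

(* V, GL(n, R) and Aut(V), each with a single chart: the linear coordinates
   of V, and the matrix entries on the other two *)
Definition vect_chart : chart 'rV[R]_n V := Chart setT (coords e) (lincomb e).

Definition vect_charted : charted 'rV[R]_n V :=
  Charted [set vect_chart] (fun=> vect_chart).

Definition GL_chart : chart 'M[R]_n (GL n) := Chart setT val (insubd (GL1 n)).

Definition GL_charted : charted 'M[R]_n (GL n) :=
  Charted [set GL_chart] (fun=> GL_chart).

Definition Aut_chart : chart 'M[R]_n (Aut V) :=
  Chart setT (fun f => val (Zmx e f)) (fun A => Zmx_inv e (insubd (GL1 n) A)).

Definition Aut_charted : charted 'M[R]_n (Aut V) :=
  Charted [set Aut_chart] (fun=> Aut_chart).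

End LinearManifolds.
End LinearAlgebra.

Arguments GL_charted {R} n.

Section TangentGL.
Context {R : realType} {n : nat}.

Definition TGL := tangent (GL_charted (R := R) n).

(* [a, B] = T R_a (B), where B is a vector at the identity matrix *)
Definition bracket (a : GL n) (B : 'M[R]_n) : TGL :=
  tmap (fun y => GLmul y a) (Tangent (GL_charted n) (GL1 n) B).

Lemma Jmx_subproof (a : GL n) (B : 'M[R]_n) :
  block_mx (val a) 0 (B *m val a) (val a) \in unitmx.
Proof. by rewrite unitmxE det_lblock unitrM -!unitmxE !(valP a). Qed.

Definition Jmx (a : GL n) (B : 'M[R]_n) : GL (n + n) :=
  Sub (block_mx (val a) 0 (B *m val a) (val a)) (Jmx_subproof a B).

(* J_n [a, B] = (a, 0; Ba, a): xi is [a, B] for a = tbase xi and a unique B,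
   which [get] picks. *)
Definition Jn (xi : TGL) : GL (n + n) :=
  Jmx (tbase xi) (get [set B | bracket (tbase xi) B = xi]).

End TangentGL.

Section TangentVectorSpace.
Context {R : realType} {V : vectType R} {n : nat} (e : vect_basis V n).

Definition TV := tangent (vect_charted e).

(* T tau_y (X), T sigma_k (X) and the operations of TV *)
Definition ttrans (y : V) (X : TV) : TV := tmap (fun z => z + y) X.

Definition tdilate (k : R) (X : TV) : TV := tmap (fun z => k *: z) X.

Definition tplus (X Y : TV) : TV :=
  Tangent (vect_charted e) (tbase X + tbase Y)
    (tvec (ttrans (tbase Y) X) + tvec (ttrans (tbase X) Y)).

Lemma ttransE y X :
  ttrans y X = Tangent (vect_charted e) (tbase X + y) (tvec X).
Proof.
rewrite /ttrans /tmap /=; congr Tangent.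
have -> : coords e \o (fun z => z + y) \o lincomb e =
    id \+ cst (coords e y).
  by apply/funext => x /=; rewrite linearD /= lincombK.
by rewrite diff_val fctE addr0.
Qed.

Lemma tdilateE k X :
  tdilate k X = Tangent (vect_charted e) (k *: tbase X) (k *: tvec X).
Proof.
rewrite /tdilate /tmap /=; congr Tangent.
have -> : coords e \o (fun z => k *: z) \o lincomb e = k \*: id.
  by apply/funext => x /=; rewrite linearZ /= lincombK.
by rewrite diff_val.
Qed.

Lemma tplusE X Y : tplus X Y =
  Tangent (vect_charted e) (tbase X + tbase Y) (tvec X + tvec Y).
Proof. by rewrite /tplus !ttransE. Qed.

Definition psi (X : TV) : V * 'rV[R]_n :=
  (tbase X, \row_i dirder X (coord e i)).

Definition psi_inv (q : V * 'rV[R]_n) : TV := Tangent (vect_charted e) q.1 q.2.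

Lemma psiE X : psi X = (tbase X, tvec X).
Proof.
congr pair; apply/rowP => i; rewrite mxE /dirder /=.
have coordE (x : 'rV[R]_n) : coord e i (lincomb e x) = x 0 i.
  by rewrite -[x in RHS](lincombK e) mxE.
pose f : {linear 'rV[R]_n -> R} := coord e i \o lincomb e.
have fC : continuous f.
  have -> : f = (fun x : 'rV[R]_n => x 0 i) :> (_ -> _) by exact/funext.
  exact: coord_continuous.
rewrite -coordE.
exact: (congr1 (fun g => g (tvec X)) (diff_lin (coords e (tbase X)) fC)).
Qed.

Lemma psiK : cancel psi psi_inv.
Proof. by move=> [p v]; rewrite psiE. Qed.

Lemma psi_invK : cancel psi_inv psi.
Proof. by move=> [p v]; rewrite psiE. Qed.

HB.instance Definition _ := gen_eqMixin TV.
HB.instance Definition _ := gen_choiceMixin TV.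

Let T0 : TV := Tangent (vect_charted e) 0 0.
Let Topp : TV -> TV := tdilate (-1).

Fact tplusA : associative tplus.
Proof. by move=> X Y Z; rewrite !tplusE /= !addrA. Qed.
Fact tplusC : commutative tplus.
Proof.
by move=> X Y; rewrite !tplusE (addrC (tbase X)) (addrC (tvec X)).
Qed.
Fact tplus0 : left_id T0 tplus.
Proof. by move=> [p v]; rewrite tplusE /= !add0r. Qed.
Fact tplusN : left_inverse T0 Topp tplus.
Proof.
by move=> [p v]; rewrite tplusE /Topp tdilateE /= !scaleN1r !addNr.
Qed.

HB.instance Definition _ :=
  GRing.isZmodule.Build TV tplusA tplusC tplus0 tplusN.

Fact tdilateA k l X : tdilate k (tdilate l X) = tdilate (k * l) X.
Proof. by rewrite !tdilateE /= !scalerA. Qed.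
Fact tdilate1 : left_id 1 tdilate.
Proof. by move=> [p v]; rewrite tdilateE /= !scale1r. Qed.
Lemma TVaddE (X Y : TV) : X + Y = tplus X Y. Proof. by []. Qed.
Fact tdilateDr : right_distributive tdilate +%R.
Proof. by move=> k X Y; rewrite !TVaddE !tplusE !tdilateE /= !scalerDr. Qed.
Fact tdilateDl X : {morph tdilate^~ X : k l / k + l}.
Proof. by move=> k l /=; rewrite TVaddE tplusE !tdilateE /= !scalerDl. Qed.

HB.instance Definition _ :=
  GRing.Zmodule_isLmodule.Build R TV tdilateA tdilate1 tdilateDr tdilateDl.

Lemma TVscaleE k (X : TV) : k *: X = tdilate k X. Proof. by []. Qed.

Fact TV_vect_iso : Vector.axiom (n + n) TV.
Proof.
exists (fun X => row_mx (coords e (tbase X)) (tvec X)).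
  move=> k [p v] [q w]; rewrite TVaddE TVscaleE tplusE tdilateE /=.
  by rewrite linearP scale_row_mx add_row_mx.
exists (fun x => psi_inv (lincomb e (lsubmx x), rsubmx x)) => [[p v]|x] /=.
  by rewrite row_mxKl row_mxKr coordsK.
by rewrite lincombK hsubmxK.
Qed.

HB.instance Definition _ := Lmodule_hasFinDim.Build R TV TV_vect_iso.

Definition alpha_t (i : 'I_n) : TV := psi_inv (tnth e i, 0).
Definition y_t (i : 'I_n) : TV := psi_inv (0, delta_mx 0 i).

Definition TV_tuple : (n + n).-tuple TV :=
  cat_tuple (mktuple alpha_t) (mktuple y_t).

Lemma TV_tupleP : basis_of fullv TV_tuple.
Proof.
rewrite basisEdim size_tuple dimvf leqnn andbT; apply/subvP => -[p v] _.
have -> : Tangent _ p v = \sum_i coord e i p *: alpha_t i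
                          + \sum_i v 0 i *: y_t i :> TV.
  have sumE (I : finType) (F : I -> TV) : \sum_i F i =
      psi_inv (\sum_i tbase (F i), \sum_i tvec (F i)).
    apply: (big_ind3 (fun X q w => X = psi_inv (q, w)))
      => [|_ q w _ r u -> ->|i _] //.
      by rewrite TVaddE tplusE.
    by case: (F i).
  have scaleE k q w : k *: psi_inv (q, w) = psi_inv (k *: q, k *: w) :> TV.
    by rewrite TVscaleE tdilateE.
  under eq_bigr do rewrite scaleE scaler0.
  under [X in _ + X]eq_bigr do rewrite scaleE scaler0.
  rewrite !sumE TVaddE tplusE /= !big1_eq addr0 add0r -row_sum_delta.
  rewrite {1}[p](coord_basis (basisP e) (memvf _)); congr Tangent.
  by apply: eq_bigr => i _; rewrite (tnth_nth 0).
apply: memvD; apply: memv_suml => i _; apply: memvZ; apply: memv_span.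
  by rewrite mem_cat map_f ?mem_enum.
by rewrite mem_cat orbC map_f ?mem_enum.
Qed.

Definition TV_basis : vect_basis TV (n + n) := VectBasis TV_tupleP.

End TangentVectorSpace.

Section Representation.
Context {R : realType} {m n : nat} {G : groupType} (cG : charted 'rV[R]_m G).
Context {V : vectType R} (e : vect_basis V n).

(* Lie group homomorphisms from G to Aut(V) *)
Record is_representation (Phi : G -> Aut V) : Prop := IsRepresentation {
  repr_mul : forall a b v,
    val (Phi (a * b)%g) v = val (Phi a) (val (Phi b) v);
  repr_smooth : smooth_map cG (Aut_charted e) Phi }.

Definition rep_action (Phi : G -> Aut V) (x : G * V) : V := val (Phi x.1) x.2.

(* T rho : TG * TV -> TV *)
Definition tangent_action (Phi : G -> Aut V) (x : tangent cG * TV e) : TV e :=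
  tmap (rep_action Phi) (tpair x.1 x.2).

Definition prolongation (Phi : G -> Aut V) (X : tangent cG) : Aut (TV e) :=
  let TPhi : tangent cG -> tangent (Aut_charted e) := tmap Phi in
  let TZ : tangent (Aut_charted e) -> TGL (n := n) := tmap (Zmx e) in
  Zmx_inv (TV_basis e) (Jn (TZ (TPhi X))).

End Representation.

Arguments tangent_action {R m n G} cG {V} e Phi x.
Arguments prolongation {R m n G} cG {V} e Phi X.

(* Main.v *)
Require Import Defs.
From HB Require Import structures.
From mathcomp Require Import all_boot all_order all_algebra perm.
From mathcomp Require Import all_classical all_reals.
From mathcomp Require Import topology normedtype landau derive.
Import Order.TTheory GRing.Theory Num.Theory.
Import numFieldNormedType.Exports.

Set Implicit Arguments.
Unset Strict Implicit.
Unset Printing Implicit Defensive.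

Local Open Scope classical_set_scope.
Local Open Scope ring_scope.

(* Let A(p) be the transposed matrix of Phi(p), so that in the linear
   coordinates of V the action is (p, y) |-> y A(p).  By the product rule,
   T rho sends ((p, v), (y, w)) to (y A(p), w A(p) + y dA_p(v)).  This formula
   is smooth in charts, since dA_p(v) is a combination of partial derivatives of
   A with coefficients linear in v; it is also the value at (y, w) of the block
   matrix J_n of T Z (T Phi (p, v)).  The action axioms follow from A(1) = 1 and
   from differentiating A(p q) = A(q) A(p). *)

(* Writes the scaling by a coordinate of v as matrix products, so that [Ck_mulmx]
   applies to it. *)
Lemma coord_row_mulmx (R : comNzRingType) m n (v : 'rV[R]_m) i (r : 'rV[R]_n) :
  (v *m delta_mx i (0 : 'I_1)) *m r = v 0 i *: r.
Proof. by rewrite -colE [col _ _]mx11_scalar mul_scalar_mx !mxE. Qed.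

(** * Continuity of matrix-valued maps *)

Section Continuity.
Context {R : realType}.

(** A neighbourhood of a matrix contains a box of entrywise neighbourhoods, and a filter is closed
    under the finite intersection over all entries. *)
Lemma mx_continuous (T : topologicalType) m n (f : T -> 'M[R]_(m, n)) x :
  (forall i j, {for x, continuous (fun y => f y i j)}) ->
  {for x, continuous f}.
Proof.
move=> fc A [P PA sPA].
apply: (@filterS _ (nbhs x) _ [set y | forall i, forall j, P i j (f y i j)]).
  by move=> y yP; apply: sPA.
apply: filter_forall => i; apply: filter_forall => j.
exact: fc (PA i j).
Qed.

Lemma mulmx_continuous m n p :
  continuous (fun q : 'M[R]_(m, n) * 'M[R]_(n, p) => q.1 *m q.2).
Proof.
move=> q; apply: mx_continuous => i j.
have -> : (fun y : 'M[R]_(m, n) * 'M[R]_(n, p) => (y.1 *m y.2) i j) =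
    \sum_k (fun y : 'M[R]_(m, n) * 'M[R]_(n, p) => y.1 i k * y.2 k j).
  by apply/funext => y; rewrite mxE fct_sumE.
elim/big_ind: _ => [|f g fc gc|k _]; first exact: cst_continuous.
  exact: continuousD.
apply: continuousM.
  apply: (@continuous_comp _ _ _ (@fst 'M[R]_(m, n) 'M[R]_(n, p))
    (fun A : 'M[R]_(m, n) => A i k)); first exact: cvg_fst.
  exact: coord_continuous.
apply: (@continuous_comp _ _ _ (@snd 'M[R]_(m, n) 'M[R]_(n, p))
  (fun A : 'M[R]_(n, p) => A k j)); first exact: cvg_snd.
exact: coord_continuous.
Qed.

Lemma trmx_continuous m n : continuous (@trmx R m n).
Proof.
move=> A; apply: mx_continuous => i j.
rewrite (_ : (fun _ => _) = fun y : 'M_(m, n) => y j i); first exact: coord_continuous.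
by apply/funext => y; rewrite mxE.
Qed.

End Continuity.

(** * Differentials: locality, linear maps, matrix products *)

Section Differential.
Context {R : realType} {E F : normedModType R}.

(** Locality of the differential: the first-order expansion of [f] is also one of [g], and
    [diff_unique] concludes. It allows [cinv] and [insubd], meaningful only on part of the model
    space, to be simplified near a point. *)
Lemma near_eq_is_diff (f g df : E -> F) x :
  (\forall y \near x, f y = g y) -> is_diff x f df -> is_diff x g df.
Proof.
move=> fg dfx; have fgx := nbhs_singleton fg.
have gxE : g \o shift x = cst (g x) + 'd f x +o_ 0 id.
  have /eqaddoP fo := diff_locally (@ex_diff _ _ _ _ _ _ _ dfx).
  apply/eqaddoP => eps eps0; have := fo eps eps0.
  move: fg; rewrite (near_shift 0) /= subr0; apply: filterS2 => y /=.
  by rewrite !fctE /= fgx => ->.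
have dgE : 'd g x = 'd f x :> (E -> F).
  by apply: diff_unique gxE; apply: diff_continuous.
apply: DiffDef; last by rewrite dgE diff_val.
by apply/diff_locallyP; rewrite dgE; split=> //; apply: diff_continuous.
Qed.

Lemma is_diffE (f df : E -> F) x h : is_diff x f df -> 'd f x h = df h.
Proof. by case=> _ ->. Qed.

Lemma is_diff_unique (f df dg : E -> F) x :
  is_diff x f df -> is_diff x f dg -> df = dg.
Proof. by case=> _ <- [_ <-]. Qed.

Lemma is_diff_lin (L : {linear E -> F}) x : continuous L -> is_diff x L L.
Proof.
by move=> Lc; apply: DiffDef; [exact: linear_differentiable|exact: diff_lin].
Qed.

Lemma fst_continuous : continuous (@fst E F).
Proof. by move=> x; exact: cvg_fst. Qed.

Lemma snd_continuous : continuous (@snd E F).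
Proof. by move=> x; exact: cvg_snd. Qed.

Lemma is_diff_fst x : is_diff x (@fst E F) fst.
Proof.
by apply: DiffDef; [apply: linear_differentiable|apply: diff_lin];
  exact: fst_continuous.
Qed.

Lemma is_diff_snd x : is_diff x (@snd E F) snd.
Proof.
by apply: DiffDef; [apply: linear_differentiable|apply: diff_lin];
  exact: snd_continuous.
Qed.

Lemma is_diff_mulmx m n p (f df : E -> 'M[R]_(m, n)) (g dg : E -> 'M[R]_(n, p)) x :
  is_diff x f df -> is_diff x g dg ->
  is_diff x (fun y => f y *m g y) (fun h => f x *m dg h + df h *m g x).
Proof.
move=> dfx dgx.
have Bc := @mulmx_continuous R m n p.
have dB : is_diff (f x, g x) (fun q => q.1 *m q.2)
    (fun q => f x *m q.2 + q.1 *m g x).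
  apply: DiffDef; first exact: differentiable_bilin Bc.
  exact: diff_bilin Bc.
exact: (@is_diff_comp _ _ _ _ (fun y => (f y, g y)) _ _ _ x).
Qed.

(** Trades a differential in an arbitrary direction for derivatives along fixed vectors, the ones
    that [Ck] controls. *)
Lemma diff_row_sum m (f : 'rV[R]_m -> F) x v :
  differentiable f x -> 'd f x v = \sum_i v 0 i *: 'D_(delta_mx 0 i) f x.
Proof.
move=> fx; rewrite {1}[v]row_sum_delta linear_sum; apply: eq_bigr => i _.
by rewrite linearZ deriveE.
Qed.

End Differential.

Lemma is_diff_mulmx_sep {R : realType} {E F : normedModType R} m n p
    (f df : E -> 'M[R]_(n, p)) (g dg : F -> 'M[R]_(m, n)) (a : E * F) :
  is_diff (a.1) f df -> is_diff (a.2) g dg ->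
  is_diff a (fun z : E * F => g z.2 *m f z.1)
            (fun h : E * F => g a.2 *m df h.1 + dg h.2 *m f a.1).
Proof.
move=> dfa dga; apply: (@is_diff_mulmx _ _ _ _ _ (g \o snd) (dg \o snd) (f \o fst) (df \o fst)).
  exact: is_diff_comp (is_diff_snd _) dga.
exact: is_diff_comp (is_diff_fst _) dfa.
Qed.

Lemma pair_coord_continuous {R : realType} (T1 T2 T3 T4 : normedModType R) :
  [/\ continuous (fst \o fst : ((T1 * T2) * (T3 * T4))%type -> T1),
      continuous (snd \o fst : ((T1 * T2) * (T3 * T4))%type -> T2),
      continuous (fst \o snd : ((T1 * T2) * (T3 * T4))%type -> T3) &
      continuous (snd \o snd : ((T1 * T2) * (T3 * T4))%type -> T4)].
Proof.
split=> z; apply: continuous_comp;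
  do ?[exact: fst_continuous|exact: snd_continuous].
Qed.

(** * Closure properties of maps of class C^k *)

Section Ck.
Context {R : realType}.
Implicit Types E F : normedModType R.

(** As [U] is open, equality on [U] is equality near each of its points, so derivatives on [U] agree
    at every order whatever happens outside. *)
Lemma Ck_eq k E F (U : set E) (f g : E -> F) :
  open U -> (forall x, U x -> f x = g x) -> Ck k U f -> Ck k U g.
Proof.
elim: k f g => [|k IHk] f g Uo fg /=.
  move=> fc x Ux; have /fc fx := Ux.
  rewrite /prop_for /continuous_at -(fg _ Ux).
  apply: cvg_trans fx; apply: near_eq_cvg.
  by apply: filterS (open_nbhs_nbhs (conj Uo Ux)) => y /fg.
have fgn x : U x -> \forall y \near x, f y = g y.
  by move=> Ux; apply: filterS (open_nbhs_nbhs (conj Uo Ux)) => y /fg.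
case=> fd fDk; split=> [x Ux|v].
  have /differentiableP dfx := fd _ Ux.
  exact: (@ex_diff _ _ _ _ _ _ _ (near_eq_is_diff (fgn _ Ux) dfx)).
apply: IHk (fDk v) => // x Ux; exact: near_eq_derive (fgn _ Ux).
Qed.

Lemma CkW k E F (U : set E) (f : E -> F) : Ck k.+1 U f -> Ck k U f.
Proof.
elim: k f => [|k IHk] f [fd fDk].
  by move=> x /fd; exact: differentiable_continuous.
by split=> // v; apply: IHk.
Qed.

Lemma Ck_cst k E F (U : set E) (a : F) : Ck k U (cst a).
Proof.
elim: k a => [|k IHk] a; first by move=> x _; exact: cst_continuous.
split=> [x _|v]; first exact: differentiable_cst.
rewrite (_ : (fun _ => _) = cst 0) //.
by apply/funext => x; rewrite derive_cst.
Qed.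

Lemma Ck_linear k E F (U : set E) (L : {linear E -> F}) :
  continuous L -> Ck k U L.
Proof.
move=> Lc; case: k => [|k]; first by move=> x _; exact: Lc.
split=> [x _|v]; first exact: linear_differentiable.
rewrite (_ : (fun _ => _) = cst (L v)); first exact: Ck_cst.
by apply/funext => x; rewrite deriveE ?diff_lin//; exact: linear_differentiable.
Qed.

Lemma CkD k E F (U : set E) (f g : E -> F) : open U ->
  Ck k U f -> Ck k U g -> Ck k U (fun x => f x + g x).
Proof.
move=> Uo; elim: k f g => [|k IHk] f g.
  by move=> fc gc x Ux; apply: continuousD; [exact: fc|exact: gc].
move=> [fd fDk] [gd gDk]; split=> [x Ux|v].
  by apply: differentiableD; [exact: fd|exact: gd].
apply: Ck_eq (IHk _ _ (fDk v) (gDk v)) => // x Ux.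
by rewrite deriveD //; apply: diff_derivable; [exact: fd|exact: gd].
Qed.

Lemma Ck_sum k E F (U : set E) (I : finType) (f : I -> E -> F) : open U ->
  (forall i, Ck k U (f i)) -> Ck k U (fun x => \sum_i f i x).
Proof.
move=> Uo fCk; rewrite (_ : (fun _ => _) = \sum_i f i); last first.
  by apply/funext => x; rewrite fct_sumE.
elim/big_ind: _ => [|g h gCk hCk|i _]; first exact: Ck_cst.
  exact: CkD.
exact: fCk.
Qed.

(** Induction by the Leibniz rule: each term has one differentiated factor, of class [k], and one
    undifferentiated factor, brought down from [k.+1] to [k] by [CkW]. *)
Lemma Ck_mulmx k E m n p (U : set E) (f : E -> 'M[R]_(m, n))
    (g : E -> 'M[R]_(n, p)) : open U ->
  Ck k U f -> Ck k U g -> Ck k U (fun x => f x *m g x).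
Proof.
move=> Uo; elim: k f g => [|k IHk] f g.
  move=> fc gc x Ux.
  apply: (@continuous_comp _ _ _ (fun y => (f y, g y))
    (fun q : 'M[R]_(m, n) * 'M[R]_(n, p) => q.1 *m q.2)).
    apply: (@cvg_pair _ _ _ (nbhs x) (nbhs (f x)) (nbhs (g x))); [exact: fc|exact: gc].
  exact: mulmx_continuous.
move=> fk gk; have [[fd fDk] [gd gDk]] := (fk, gk).
have dfg x : U x -> is_diff x (fun y => f y *m g y)
    (fun h => f x *m 'd g x h + 'd f x h *m g x).
  by move=> Ux; apply: is_diff_mulmx; apply: differentiableP; [exact: fd|exact: gd].
split=> [x /dfg dx|v]; first exact: ex_diff.
apply: Ck_eq (CkD Uo (IHk _ _ (CkW fk) (gDk v)) (IHk _ _ (fDk v) (CkW gk))) => //.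
move=> x Ux; have dx := dfg _ Ux.
rewrite [RHS]deriveE; last exact: ex_diff.
by rewrite diff_val !deriveE //; [exact: fd|exact: gd].
Qed.

Lemma Ck_lin_comp k E F F' (U : set E) (L : {linear F -> F'}) (f : E -> F) :
  open U -> continuous L -> Ck k U f -> Ck k U (L \o f).
Proof.
move=> Uo Lc; elim: k f => [|k IHk] f.
  by move=> fc x Ux; apply: continuous_comp; [exact: fc|exact: Lc].
move=> [fd fDk]; split=> [x Ux|v].
  by apply: differentiable_comp; [exact: fd|exact: linear_differentiable].
apply: Ck_eq (IHk _ (fDk v)) => // x Ux /=; have fx := fd _ Ux.
have Ld := linear_differentiable (f x) Lc.
have Lfd := differentiable_comp fx Ld.
by rewrite (deriveE _ fx) (deriveE _ Lfd) (diff_comp fx Ld) /= (diff_lin (f x) Lc).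
Qed.

(** The derivative of [f \o L] along [v] is the derivative of [f] along the fixed vector [L v],
    composed with [L]; the induction therefore stays within compositions with [L]. *)
Lemma Ck_comp_lin k E E' F (U : set E) (L : {linear E' -> E}) (f : E -> F) :
  open U -> continuous L -> Ck k U f -> Ck k (L @^-1` U) (f \o L).
Proof.
move=> Uo Lc; have LUo : open (L @^-1` U) by apply: open_comp.
elim: k f => [|k IHk] f.
  by move=> fc x Ux; apply: continuous_comp; [exact: Lc|exact: fc].
move=> [fd fDk]; split=> [x Ux|v].
  by apply: differentiable_comp; [exact: linear_differentiable|exact: fd].
apply: Ck_eq (IHk _ (fDk (L v))) => // x Ux /=; have fx := fd _ Ux.
have Ld := linear_differentiable x Lc.
have Lfd := differentiable_comp Ld fx.
by rewrite (deriveE _ fx) (deriveE _ Lfd) (diff_comp Ld fx) /= (diff_lin x Lc).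
Qed.

Lemma Ck_pair k E F F' (U : set E) (f : E -> F) (g : E -> F') :
  open U -> Ck k U f -> Ck k U g -> Ck k U (fun x => (f x, g x)).
Proof.
move=> Uo; elim: k f g => [|k IHk] f g.
  move=> fc gc x Ux.
  by apply: (@cvg_pair _ _ _ (nbhs x) (nbhs (f x)) (nbhs (g x))); [exact: fc|exact: gc].
move=> [fd fDk] [gd gDk]; split=> [x Ux|v].
  by apply: differentiable_pair; [exact: fd|exact: gd].
apply: Ck_eq (IHk _ _ (fDk v) (gDk v)) => // x Ux; have [fx gx] := (fd _ Ux, gd _ Ux).
have fgx := differentiable_pair fx gx.
by rewrite (deriveE _ fx) (deriveE _ gx) (deriveE _ fgx) diff_pair.
Qed.

End Ck.

(** * Differentiation in charts and change of chart *)

Section Charts.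
Context {R : realType} {E : normedModType R} {M : Type} {cM : charted E M}.
Hypothesis hM : is_manifold cM.

Lemma chart_image_open c : atlas cM c -> open (cmap c @` cdom c).
Proof. by move=> hc; have := overlap_open hM hc hc; rewrite setIid. Qed.

(** By [overlap_open] the image of the overlap is a neighbourhood of [cmap c p], and its points have
    the form [cmap c q], where [chartK] applies. *)
Lemma overlap_near b c p : atlas cM b -> atlas cM c -> cdom b p -> cdom c p ->
  \forall z \near cmap c p,
    [/\ cdom c (cinv c z), cdom b (cinv c z) & cmap c (cinv c z) = z].
Proof.
move=> hb hc bp cp.
have zU : (cmap c @` (cdom c `&` cdom b)) (cmap c p) by exists p.
apply: filterS (open_nbhs_nbhs (conj (overlap_open hM hc hb) zU)).
by move=> _ [q [cq bq] <-]; rewrite (chartK hM hc cq).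
Qed.

Lemma chart_near c p : atlas cM c -> cdom c p ->
  \forall z \near cmap c p, cdom c (cinv c z) /\ cmap c (cinv c z) = z.
Proof.
by move=> hc cp; apply: filterS (overlap_near hc hc cp cp) => z [].
Qed.

Lemma transition_differentiable b c p :
  atlas cM b -> atlas cM c -> cdom b p -> cdom c p ->
  differentiable (cmap b \o cinv c) (cmap c p).
Proof.
move=> hb hc bp cp; have [d _] := transition_smooth hM hc hb 1.
by apply: d; exists p.
Qed.

(** Near [cmap c p], [f \o cinv c] is [f \o cinv b] after the transition map, so this is the chain
    rule. *)
Lemma is_diff_chart_change (F : normedModType R) (f : M -> F) df b c p :
  atlas cM b -> atlas cM c -> cdom b p -> cdom c p ->
  is_diff (cmap b p) (f \o cinv b) df ->
  is_diff (cmap c p) (f \o cinv c) (df \o 'd (cmap b \o cinv c) (cmap c p)).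
Proof.
move=> hb hc bp cp dfp.
have dt := differentiableP (transition_differentiable hb hc bp cp).
apply: (@near_eq_is_diff _ _ _ ((f \o cinv b) \o (cmap b \o cinv c))).
  apply: filterS (overlap_near hb hc bp cp) => z [_ bz _] /=.
  by rewrite (chartK hM hb bz).
by apply: is_diff_comp; rewrite /= (chartK hM hc cp).
Qed.

Lemma is_diff_chart_id c p : atlas cM c -> cdom c p ->
  is_diff (cmap c p) (cmap c \o cinv c) id.
Proof.
move=> hc cp; apply: near_eq_is_diff (is_diff_id _).
by apply: filterS (chart_near hc cp) => z [].
Qed.

(** The composite is the differential of [cmap c \o cinv c] computed through [b], and that map is
    the identity near [cmap c p]. *)
Lemma transition_diffK b c p v :
  atlas cM b -> atlas cM c -> cdom b p -> cdom c p ->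
  'd (cmap c \o cinv b) (cmap b p) ('d (cmap b \o cinv c) (cmap c p) v) = v.
Proof.
move=> hb hc bp cp.
have dt := differentiableP (transition_differentiable hc hb cp bp).
have d1 := is_diff_chart_change hb hc bp cp dt.
have d2 := is_diff_chart_id hc cp.
by have := is_diff_unique d1 d2 => /(congr1 (fun g => g v)).
Qed.

End Charts.

(** * Tangent vectors of a product *)

Section Pairs.
Context {R : realType} {E F : normedModType R} {M N : Type}.
Context {cM : charted E M} {cN : charted F N}.
Hypothesis (hM : is_manifold cM) (hN : is_manifold cN).

(** Each summand of [tpair] freezes one factor and is the identity in the preferred chart of the
    other, hence contributes [(0, w)] or [(v, 0)]. *)
Lemma tpairE (X : tangent cM) (Y : tangent cN) :
  tpair X Y = Tangent (prod_charted cM cN) (tbase X, tbase Y) (tvec X, tvec Y).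
Proof.
case: X Y => [p v] [q w]; rewrite /tpair /tmap /=; congr Tangent.
have [hp hq] := (chart_at_atlas hM p, chart_at_atlas hN q).
have [dp dq] := (chart_at_dom hM p, chart_at_dom hN q).
have dY : is_diff (cmap (chart_at cN q) q)
    (fun z => (cmap (chart_at cM p) p,
               cmap (chart_at cN q) (cinv (chart_at cN q) z)))
    (fun z => (0, z)).
  exact: is_diff_pair (is_diff_cst _ _) (is_diff_chart_id hN hq dq).
have dX : is_diff (cmap (chart_at cM p) p)
    (fun z => (cmap (chart_at cM p) (cinv (chart_at cM p) z),
               cmap (chart_at cN q) q))
    (fun z => (z, 0)).
  exact: is_diff_pair (is_diff_chart_id hM hp dp) (is_diff_cst _ _).
rewrite (is_diffE w dY) (is_diffE v dX).
by congr pair; rewrite /= ?add0r ?addr0.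
Qed.

End Pairs.

(** * A vector space as a manifold *)

Section VectorSpaceManifold.
Context {R : realType} {V : vectType R} {n : nat} (e : vect_basis V n).

Lemma is_diff_vect_chart x :
  is_diff x (coords e \o lincomb e) id.
Proof.
have -> : coords e \o lincomb e = id by apply/funext => y /=; rewrite lincombK.
exact: is_diff_id.
Qed.

Lemma coords_image : coords e @` setT = setT.
Proof. by apply/seteqP; split=> // x _; exists (lincomb e x); rewrite ?lincombK. Qed.

Lemma vect_manifold : is_manifold (vect_charted e).
Proof.
split=> //= [_ -> v _|c d -> ->|c d -> ->] /=; first by rewrite coordsK.
  by rewrite setIT coords_image; exact: openT.
move=> k.
have -> : coords e \o lincomb e = idfun by apply/funext => y /=; rewrite lincombK.
apply: (@Ck_linear _ k _ _ _ (idfun : {linear 'rV[R]_n -> 'rV[R]_n})) => x.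
exact: cvg_id.
Qed.

End VectorSpaceManifold.

(* The transpose, since coordinates of vectors are rows. *)
Definition rep_matrix {R : realType} {n : nat} {G : groupType} {V : vectType R}
    (e : vect_basis V n) (Phi : G -> Aut V) (p : G) : 'M[R]_n :=
  (fmat e (val (Phi p)))^T.

(** * The formula for the tangent action and the action axioms *)

Section Action.
Context {R : realType} {m n : nat} {G : groupType} {cG : charted 'rV[R]_m G}.
Context {V : vectType R} {e : vect_basis V n} {Phi : G -> Aut V}.
Hypothesis (hG : is_lie_group cG) (hPhi : is_representation cG e Phi).

Let hM : is_manifold cG := lie_manifold hG.

Local Notation A := (rep_matrix e Phi).

Lemma coords_rep_action p y :
  coords e (rep_action Phi (p, y)) = coords e y *m A p.
Proof. exact: coords_fmat. Qed.

Lemma rep_matrix_mul p q : A (p * q)%g = A q *m A p.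
Proof.
rewrite /rep_matrix -trmx_mul; congr trmx; apply: (can_inj (mxfunK e)).
apply/lfunP => v; apply: (can_inj (coordsK e)).
by rewrite !coords_mxfun trmx_mul mulmxA -!coords_fmat (repr_mul hPhi).
Qed.

(** [Phi 1] is idempotent and injective. *)
Lemma rep_one y : val (Phi 1%g) y = y.
Proof.
have /lker0P inj1 := valP (Phi 1%g).
by apply: inj1; rewrite -(repr_mul hPhi) mulg1.
Qed.

Lemma rep_matrix_one : A 1%g = 1%:M.
Proof.
apply/row_matrixP => i; rewrite !rowE mulmx1 -[delta_mx 0 i](lincombK e).
by rewrite -coords_rep_action /rep_action rep_one.
Qed.

(** The single chart of [Aut V] reads off [fmat], so smoothness of [Phi] is smoothness of its
    matrix; transposition is continuous and linear. *)
Lemma rep_matrix_smooth c : atlas cG c ->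
  smooth_on (cmap c @` cdom c) (A \o cinv c).
Proof.
move=> hc k; have [_ /(_ k)] := repr_smooth hPhi hc (erefl (Aut_chart e)).
rewrite preimage_setT setIT.
exact: (@Ck_lin_comp _ k _ _ _ _ trmx _ (chart_image_open hM hc)
  (@trmx_continuous R n n)).
Qed.

Lemma rep_matrix_is_diff c p : atlas cG c -> cdom c p ->
  is_diff (cmap c p) (A \o cinv c) ('d (A \o cinv c) (cmap c p)).
Proof.
move=> hc cp; have [d _] := rep_matrix_smooth hc 1.
by apply: differentiableP; apply: d; exists p.
Qed.

Lemma tangent_actionE X Y : tangent_action cG e Phi (X, Y) =
  let c := chart_at cG (tbase X) in
  Tangent (vect_charted e) (val (Phi (tbase X)) (tbase Y))
    (tvec Y *m A (tbase X) +
     coords e (tbase Y) *m 'd (A \o cinv c) (cmap c (tbase X)) (tvec X)).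
Proof.
case: X Y => [p v] [y w]; rewrite /tangent_action.
rewrite (tpairE hM (vect_manifold e)) /tmap /=; congr Tangent.
set c := chart_at cG p; have [hc cp] := (chart_at_atlas hM p, chart_at_dom hM p).
have dA := rep_matrix_is_diff hc cp.
pose a := (cmap c p, coords e y).
have d12 := @is_diff_mulmx_sep _ _ _ _ _ _ _ _ _ _ a dA (is_diff_id _).
(* The chart of [V] is global, so this equality holds everywhere and not just near [a]. *)
have fE : coords e \o rep_action Phi \o
    (fun x : 'rV[R]_m * 'rV[R]_n => (cinv c x.1, lincomb e x.2)) =
    fun q => id q.2 *m (A \o cinv c) q.1.
  by apply/funext => q /=; rewrite coords_rep_action lincombK.
rewrite fE -/a (is_diffE (v, w) d12) /=.
by rewrite (chartK hM hc cp) addrC.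
Qed.

(** The differential of the multiplication is left unexpanded: the action law uses only that it
    exists. *)
Lemma tmulE (X Y : tangent cG) : tmul X Y =
  let p := tbase X in let q := tbase Y in
  let c := chart_at cG p in let d := chart_at cG q in
  Tangent cG (p * q)%g
    ('d (cmap (chart_at cG (p * q)%g) \o mulG \o
         (fun x => (cinv c x.1, cinv d x.2))) (cmap c p, cmap d q)
        (tvec X, tvec Y)).
Proof. by rewrite /tmul tpairE. Qed.

Lemma tangent_action_one Y : tangent_action cG e Phi (tone cG, Y) = Y.
Proof.
case: Y => y w.
by rewrite tangent_actionE /= rep_one rep_matrix_one mulmx1 linear0 mulmx0 addr0.
Qed.

(** Base points agree since [Phi] is multiplicative. For the vector parts,
    [A (p' * q') = A q' *m A p'] is differentiated at [(p, q)] twice, by the product rule and by the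
    chain rule through the multiplication. *)
Lemma tangent_action_mul X Y Z :
  tangent_action cG e Phi (tmul X Y, Z) =
  tangent_action cG e Phi (X, tangent_action cG e Phi (Y, Z)).
Proof.
case: X Y Z => [p v] [q u] [y w].
rewrite tmulE !tangent_actionE /= (repr_mul hPhi); congr Tangent.
set c := chart_at cG p; set d := chart_at cG q; set b := chart_at cG (p * q)%g.
have [hc cp] := (chart_at_atlas hM p, chart_at_dom hM p).
have [hd dq] := (chart_at_atlas hM q, chart_at_dom hM q).
have [hb bpq] := (chart_at_atlas hM (p * q)%g, chart_at_dom hM (p * q)%g).
pose a := (cmap c p, cmap d q).
pose mu := cmap b \o mulG \o (fun x : 'rV[R]_m * 'rV[R]_m => (cinv c x.1, cinv d x.2)).
have [Uo mu_smooth] := lie_mul_smooth hG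
  (ex_intro _ c (ex_intro _ d (And3 hc hd (erefl (prod_chart c d))))) hb.
set U := (X in open X) in Uo mu_smooth.
have aU : U a by exists (p, q).
have dmu : is_diff a mu ('d mu a).
  by apply: differentiableP; have [mud _] := mu_smooth 1; apply: mud.
have mua : mu a = cmap b (p * q)%g by rewrite /mu /= /mulG /= !(chartK hM).
have dA := rep_matrix_is_diff hc cp.
have dA' := rep_matrix_is_diff hd dq.
have d12 := @is_diff_mulmx_sep _ _ _ _ _ _ _ _ _ _ a dA dA'.
have d3 : is_diff a ((A \o cinv b) \o mu) ('d (A \o cinv b) (cmap b (p * q)%g) \o 'd mu a).
  have dAb := rep_matrix_is_diff hb bpq; rewrite -mua in dAb *.
  exact: (@is_diff_comp _ _ _ _ mu _ _ _ a dmu dAb).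
have d4 : is_diff a (fun z => (A \o cinv d) z.2 *m (A \o cinv c) z.1)
    ('d (A \o cinv b) (cmap b (p * q)%g) \o 'd mu a).
  (* On the open set [U] products stay in the domain of [b], so [cinv b] undoes [cmap b] and
     [rep_matrix_mul] applies. *)
  apply: near_eq_is_diff d3; apply: filterS (open_nbhs_nbhs (conj Uo aU)).
  move=> _ [[p' q'] [[cp' dq'] bpq'] <-] /=.
  by rewrite /mu /= /mulG /= !(chartK hM) // rep_matrix_mul.
have /= dE := congr1 (fun g => g (v, u)) (is_diff_unique d12 d4).
apply: etrans (congr1 (fun B => w *m A (p * q)%g + coords e y *m B) (esym dE)) _.
rewrite !(chartK hM) // (coords_rep_action q y) rep_matrix_mul.
by rewrite mulmxDl mulmxDr !mulmxA -!addrA; congr (_ + _); rewrite addrC.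
Qed.

End Action.

(** * Smoothness of the tangent action *)

Section ActionSmooth.
Context {R : realType} {m n : nat} {G : groupType} {cG : charted 'rV[R]_m G}.
Context {V : vectType R} {e : vect_basis V n} {Phi : G -> Aut V}.
Hypothesis (hG : is_lie_group cG) (hPhi : is_representation cG e Phi).

Let hM : is_manifold cG := lie_manifold hG.

Local Notation A := (rep_matrix e Phi).

Local Notation coordTGV := (('rV[R]_m * 'rV[R]_m) * ('rV[R]_n * 'rV[R]_n))%type.

(** Points are [((x, v), (y, w))], base point before vector, for [G] and then for [V]. Only [x] is
    confined, the chart of [V] being global. *)
Local Notation W c := [set z : coordTGV | (cmap c @` cdom c) z.1.1].

Lemma action_domain_open c : atlas cG c -> open (W c).
Proof.
move=> hc; have [c11 _ _ _]
  := pair_coord_continuous 'rV[R]_m 'rV[R]_m 'rV[R]_n 'rV[R]_n.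
by apply: (open_comp (f := fst \o fst)) (chart_image_open hM hc) => z _; exact: c11.
Qed.

Lemma local_action_smooth c : atlas cG c ->
  smooth_on (W c) (fun z : coordTGV =>
    (z.2.1 *m (A \o cinv c) z.1.1,
     z.2.2 *m (A \o cinv c) z.1.1 + z.2.1 *m 'd (A \o cinv c) (z.1.1) z.1.2)).
Proof.
move=> hc k; have Wo := action_domain_open hc.
have [c11 c12 c21 c22]
  := pair_coord_continuous 'rV[R]_m 'rV[R]_m 'rV[R]_n 'rV[R]_n.
have Vo := chart_image_open hM hc.
have k11 := fun f => @Ck_comp_lin _ k _ coordTGV 'M[R]_n _ (fst \o fst) f Vo c11.
have k12 := @Ck_linear _ k _ _ (W c) (snd \o fst) c12.
have k21 := @Ck_linear _ k _ _ (W c) (fst \o snd) c21.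
have k22 := @Ck_linear _ k _ _ (W c) (snd \o snd) c22.
have kA := k11 _ (rep_matrix_smooth hG hPhi hc k).
apply: Ck_pair => //; first exact: Ck_mulmx Wo k21 kA.
apply: CkD => //; first exact: Ck_mulmx Wo k22 kA.
(* One extra order of smoothness of [A] pays for its partial derivatives. *)
have [Ad ADk] := rep_matrix_smooth hG hPhi hc k.+1.
have kD i := k11 _ (ADk (delta_mx 0 i)).
(* The i-th term of [y *m dA(v)], with the scalar [v 0 i] as a 1 by 1 matrix on the left. *)
have ks i := Ck_mulmx Wo (Ck_mulmx Wo k12 (@Ck_cst _ k _ _ (W c) (delta_mx i (0 : 'I_1))))
  (Ck_mulmx Wo k21 (kD i)).
apply: Ck_eq (Ck_sum Wo ks) => // z Wz /=.
rewrite (diff_row_sum _ (Ad _ Wz)) mulmx_sumr; apply: eq_bigr => i _.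
by rewrite coord_row_mulmx scalemxAr.
Qed.

Lemma tangent_action_smooth :
  smooth_map (prod_charted (tangent_charted cG) (tangent_charted (vect_charted e)))
    (tangent_charted (vect_charted e)) (tangent_action cG e Phi).
Proof.
move=> C d [t1 [t2 [[c hc <-] [_ -> <-] ->]]] [_ -> <-] U.
have transK p v (cp : cdom c p) := transition_diffK hM v
  (chart_at_atlas hM p) hc (chart_at_dom hM p) cp.
have idE x w : 'd (coords e \o lincomb e) x w = w.
  exact: is_diffE w (is_diff_vect_chart e x).
have UE : U = W c.
  apply/seteqP; split=> [_ [[X Y] [[cX _] _] <-]|[[x v] [y w]] [p cp /= <-]].
    by exists (tbase X).
  (* The vector with coordinates [v] in [c], re-expressed in the preferred chart at [p], where
     [tvec] lives. *)
  exists (Tangent cG p ('d (cmap (chart_at cG p) \o cinv c) (cmap c p) v),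
    Tangent (vect_charted e) (lincomb e y) w); first by [].
  by rewrite /= transK // lincombK idE.
rewrite UE; split; first exact: action_domain_open.
move=> k; apply: Ck_eq (local_action_smooth hc k) => [|z].
  exact: action_domain_open.
case: z => [[x v] [y w]] [p cp xE].
have [hp dp] := (chart_at_atlas hM p, chart_at_dom hM p).
pose X := Tangent cG p ('d (cmap (chart_at cG p) \o cinv c) (cmap c p) v).
pose Y := Tangent (vect_charted e) (lincomb e y) w.
have XYE : (X, Y) = cinv (prod_chart (tangent_chart cG c)
    (tangent_chart (vect_charted e) (vect_chart e))) ((x, v), (y, w)).
  by rewrite /= -(xE : _ = x) (chartK hM hc cp) idE.
transitivity (cmap (tangent_chart (vect_charted e) (vect_chart e))
    (tangent_action cG e Phi (X, Y))); last by rewrite XYE.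
rewrite (tangent_actionE hG hPhi) -(xE : _ = x) /= (chartK hM hc cp) idE.
rewrite (coords_rep_action p (lincomb e y)) lincombK; congr (_, _ + _ *m _).
(* [tangent_actionE] differentiates [A] in the preferred chart at [p]; the chain rule carries this
   to the arbitrary chart [c]. *)
have d1 := is_diff_chart_change hM hp hc dp cp (rep_matrix_is_diff hG hPhi hp dp).
exact: is_diffE v d1.
Qed.

End ActionSmooth.

(** * The tangent bundle of the general linear group and [Jn] *)

Section GeneralLinearGroup.
Context {R : realType} {n : nat}.
Implicit Types a : GL (R := R) n.

Lemma det_continuous : continuous (@determinant R n).
Proof.
move=> x; have -> : @determinant R n =
    \sum_(s : 'S_n) ((fun=> (-1) ^+ s) * \prod_i (fun A : 'M[R]_n => A i (s i))).
  apply/funext => A; rewrite fct_sumE; apply: eq_bigr => s _.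
  by rewrite -[RHS]/(_ * _) fct_prodE.
elim/big_ind: _ => [|f g fc gc|s _]; first exact: cst_continuous.
  exact: continuousD.
apply: continuousM; first exact: cst_continuous.
elim/big_ind: _ => [|f g fc gc|i _]; first exact: cst_continuous.
  exact: continuousM.
exact: coord_continuous.
Qed.

(** Invertibility is an open condition, so near [a] the default value of [insubd] is never taken. *)
Lemma GL_near a :
  \forall z \near val a, val (insubd (GL1 n) z) = z.
Proof.
have da : \det (val a) != 0 by rewrite -unitfE -unitmxE (valP a).
have dn : \forall z \near val a, \det z != 0.
  exact: det_continuous (open_nbhs_nbhs (conj (@open_neq R 0) da)).
by apply: filterS dn => z; rewrite val_insubd unitmxE unitfE => /= ->.
Qed.

(** Right multiplication by [a] is the restriction of a linear map of matrices, which is its own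
    differential. *)
Lemma bracketE a (B : 'M[R]_n) :
  bracket a B = Tangent (GL_charted n) a (B *m val a).
Proof.
rewrite /bracket /tmap; congr Tangent; first by apply: val_inj; rewrite /= mul1mx.
have d1 : is_diff (1%:M : 'M[R]_n) (fun z => z *m val a) (fun h => h *m val a).
  have d0 := is_diff_mulmx (is_diff_id (1%:M : 'M[R]_n)) (is_diff_cst (val a) _).
  apply: (is_diff_eq d0); apply/funext => h.
  by rewrite /= [X in _ *m X]/(0 : 'M_n) mulmx0 add0r.
have fE : \forall z \near (1%:M : 'M[R]_n),
    z *m val a = val (insubd (GL1 n) z) *m val a.
  by apply: filterS (GL_near (GL1 n)) => z /= ->.
exact: is_diffE B (near_eq_is_diff fE d1).
Qed.

(** By [bracketE] the block [Ba] is the vector part of [xi] itself. Multiplying that part by the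
    inverse of [a] gives a solution [B], so [get] does not fall back on its default. *)
Lemma JnE (xi : TGL (R := R) (n := n)) : val (Jn xi) =
  block_mx (val (tbase xi)) 0 (tvec xi) (val (tbase xi)).
Proof.
rewrite /Jn; set S := [set B | _].
have /getPex : exists B, S B.
  exists (tvec xi *m invmx (val (tbase xi))).
  by rewrite /S /= bracketE mulmxKV ?(valP (tbase xi)) //; case: (xi).
by rewrite /S /= bracketE => /(congr1 (@tvec _ _ _ _)) /= ->.
Qed.

End GeneralLinearGroup.

(** * Coordinates on [TV] and the tangent map of [Z] *)

Section Prolongation.
Context {R : realType} {V : vectType R} {n : nat} (e : vect_basis V n).

Lemma tbase_sum (I : finType) (F : I -> TV e) :
  tbase (\sum_i F i) = \sum_i tbase (F i).
Proof.
by apply: (big_morph (@tbase _ _ _ _)) => // X Y; rewrite TVaddE tplusE.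
Qed.

Lemma tvec_sum (I : finType) (F : I -> TV e) :
  tvec (\sum_i F i) = \sum_i tvec (F i).
Proof.
by apply: (big_morph (@tvec _ _ _ _)) => // X Y; rewrite TVaddE tplusE.
Qed.

(** The first [n] basis vectors have zero vector part and the last [n] zero base point, so a linear
    combination splits into two independent halves. *)
Lemma coords_TV (Y : TV e) :
  coords (TV_basis e) Y = row_mx (coords e (tbase Y)) (tvec Y).
Proof.
apply: (can_inj (lincombK (TV_basis e))); rewrite coordsK.
rewrite /lincomb big_split_ord /=.
under eq_bigr do rewrite row_mxEl tnth_lshift tnth_mktuple TVscaleE tdilateE /= scaler0.
under [X in _ + X]eq_bigr do
  rewrite row_mxEr tnth_rshift tnth_mktuple TVscaleE tdilateE /= scaler0.
rewrite TVaddE tplusE !tbase_sum !tvec_sum /= !big1_eq addr0 add0r.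
by rewrite -row_sum_delta -[X in Tangent _ X _]/(lincomb e _) coordsK; case: Y.
Qed.

(** The charts of [Aut V] and [GL n] both record the matrix, so [Z] is the identity in coordinates
    near an invertible matrix. *)
Lemma tmap_ZmxE (f : Aut V) (B : 'M[R]_n) :
  tmap (Zmx e) (Tangent (Aut_charted e) f B) = Tangent (GL_charted n) (Zmx e f) B.
Proof.
rewrite /tmap; congr Tangent.
have fE : \forall z \near val (Zmx e f),
    z = val (Zmx e (Zmx_inv e (insubd (GL1 n) z))).
  by apply: filterS (GL_near (Zmx e f)) => z /= zE; rewrite mxfunK zE.
exact: is_diffE B (near_eq_is_diff fE (is_diff_id _)).
Qed.

End Prolongation.

(** * Agreement with the prolongation *)

Section TangentActionProlongation.
Context {R : realType} {m n : nat} {G : groupType} {cG : charted 'rV[R]_m G}.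
Context {V : vectType R} {e : vect_basis V n} {Phi : G -> Aut V}.
Hypothesis (hG : is_lie_group cG) (hPhi : is_representation cG e Phi).

(** The chart of [Aut V] records [fmat], the transpose of [rep_matrix], and transposition commutes
    with differentials. *)
Lemma tmap_repE (X : tangent cG) :
  tmap (cN := Aut_charted e) Phi X =
  let c := chart_at cG (tbase X) in
  Tangent (Aut_charted e) (Phi (tbase X))
    ('d (rep_matrix e Phi \o cinv c) (cmap c (tbase X)) (tvec X))^T.
Proof.
have hM := lie_manifold hG; case: X => [p v] /=.
have dA := rep_matrix_is_diff hG hPhi (chart_at_atlas hM p) (chart_at_dom hM p).
have dT := is_diff_lin ((rep_matrix e Phi \o cinv (chart_at cG p))
  (cmap (chart_at cG p) p)) (@trmx_continuous R n n).
rewrite /tmap; congr Tangent; rewrite -[RHS](is_diffE v (is_diff_comp dA dT)).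
by congr ('d _ _ v); apply/funext => z; rewrite /= trmxK.
Qed.

(** In the basis of [TV], the row [(y, w)] is multiplied by the transposed block matrix
    [(A, dA; 0, A)], which gives [(y A, y dA + w A)] as in [tangent_actionE]. *)
Lemma tangent_action_prolongation X Y :
  tangent_action cG e Phi (X, Y) = val (prolongation cG e Phi X) Y.
Proof.
apply: (can_inj (coordsK (TV_basis e))).
rewrite (tangent_actionE hG hPhi) /prolongation coords_mxfun JnE.
rewrite tmap_repE tmap_ZmxE !coords_TV /= tr_block_mx trmx0 trmxK.
by rewrite mul_row_block mulmx0 addr0 -(coords_rep_action (tbase X)) addrC.
Qed.

End TangentActionProlongation.

Theorem proposition3p7 (R : realType) (m n : nat) (G : groupType)
    (cG : charted 'rV[R]_m G) (hG : is_lie_group cG)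
    (V : vectType R) (e : vect_basis V n)
    (Phi : G -> Aut V) (hPhi : is_representation cG e Phi) :
  is_lie_action (tangent_charted cG) (tangent_charted (vect_charted e))
    (tmul (cG := cG)) (tone cG) (tangent_action cG e Phi)
  /\ (forall (X : tangent cG) (Y : TV e),
        tangent_action cG e Phi (X, Y) = val (prolongation cG e Phi X) Y).
Proof.
split; last exact: tangent_action_prolongation.
split; first exact: tangent_action_one.
  by move=> X Y Z; exact: tangent_action_mul.
exact: tangent_action_smooth.
Qed.
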